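(* Let $(N,[\cdot,\ldots,\cdot],\alpha)$ be a (multiplicative) $n$-Hom-Lie superalgebra. (i) For every $1\le i,j\le n$, $C_i(N)=C_j(N)$. (ii) Let $I$ be a graded $\alpha$-stable subspace of $N$. If $$[N,\ldots,N,\underset{i\text{-th position}}{I},N,\ldots,N]\subseteq I$$ for one position $i$, then the same inclusion holds for every position.
   Context: Vector spaces are over a field $\mathbb{K}$ of characteristic zero, and $n\ge 2$. $N=N_{\bar 0}\oplus N_{\bar 1}$ is $\mathbb{Z}_2$-graded and $|x|$ is the parity of a homogeneous $x$. A linear map is even if it preserves the grading; an $n$-linear bracket is even if $[N_{\bar k_1},\ldots,N_{\bar k_n}]\subseteq N_{\bar k_1+\cdots+\bar k_n}$. A multiplicative $n$-Hom-Lie superalgebra $(N,[\cdot,\ldots,\cdot],\alpha)$ consists of such an $N$, an even $n$-linear bracket and an even linear map $\alpha$ with $\alpha([x_1,\ldots,x_n])=[\alpha(x_1),\ldots,\alpha(x_n)]$, such that for homogeneous elements $$[\alpha(x_1),\ldots,\alpha(x_{n-1}),[y_1,\ldots,y_n]]=\sum_{i=1}^n(-1)^{|X||Y|_{i-1}}[\alpha(y_1),\ldots,\alpha(y_{i-1}),[x_1,\ldots,x_{n-1},y_i],\alpha(y_{i+1}),\ldots,\alpha(y_n)]$$ with $|X|=\sum_{k=1}^{n-1}|x_k|$, $|Y|_{i-1}=\sum_{k=1}^{i-1}|y_k|$, and $[x_1,\ldots,x_i,x_{i+1},\ldots,x_n]=-(-1)^{|x_i||x_{i+1}|}[x_1,\ldots,x_{i+1},x_i,\ldots,x_n]$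 for $1\le i\le n-1$. The $i$-th positional center is $C_i(N)=\{z\in N: [x_1,\ldots,x_{i-1},z,x_{i+1},\ldots,x_n]=0\ \text{for all } x_j\in N\}$. A subspace $I$ is graded if $I=(I\cap N_{\bar0})\oplus(I\cap N_{\bar1})$ and $\alpha$-stable if $\alpha(I)\subseteq I$. *)

(* Defs.v *)
From mathcomp Require Export all_boot all_order all_algebra.
From mathcomp Require Export perm.
From mathcomp Require Export boolp classical_sets.

Set Implicit Arguments.
Unset Strict Implicit.
Unset Printing Implicit Defensive.

Import GRing.Theory.

Local Open Scope classical_set_scope.
Local Open Scope ring_scope.

Section Definitions.

Variables (K : fieldType) (N : lmodType K).

Definition subspace (U : set N) : Prop := submod_closed [in U].

Definition direct_sum (U A B : set N) : Prop :=
  U = [set a + b | a in A & b in B] /\ A `&` B = [set 0].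

(* Parities are booleans: [gr false] is the even part, [gr true] the odd part.
   The sum in Z/2 is [addb], and the coercion [bool >-> nat] is used in the
   exponents of signs. *)
Definition grading (gr : bool -> set N) : Prop :=
  [/\ subspace (gr false), subspace (gr true)
    & direct_sum setT (gr false) (gr true)].

Definition graded (gr : bool -> set N) (I : set N) : Prop :=
  direct_sum I (I `&` gr false) (I `&` gr true).

Definition stable (f : N -> N) (I : set N) : Prop := f @` I `<=` I.

Definition even_map (gr : bool -> set N) (f : N -> N) : Prop :=
  forall p : bool, f @` gr p `<=` gr p.

Variable n : nat.

(* The n-tuple whose entry at position [i] is [z] and whose other entries are,
   in order, those of the (n-1)-tuple [x]. *)
Definition insert_at (i : 'I_n) (z : N) (x : {ffun 'I_n.-1 -> N}) :
    {ffun 'I_n -> N} :=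
  [ffun k => if unlift i k is Some j then x j else z].

Definition multilinear (br : {ffun 'I_n -> N} -> N) : Prop :=
  forall (i : 'I_n) (x : {ffun 'I_n.-1 -> N}),
    linear (fun z : N => br (insert_at i z x)).

Definition even_bracket (gr : bool -> set N) (br : {ffun 'I_n -> N} -> N) :
    Prop :=
  forall (p : 'I_n -> bool) (x : {ffun 'I_n -> N}),
    (forall i, gr (p i) (x i)) -> gr (\big[addb/false]_(i < n) p i) (br x).

Definition super_skew_symmetric (gr : bool -> set N)
    (br : {ffun 'I_n -> N} -> N) : Prop :=
  forall (p : 'I_n -> bool) (x : {ffun 'I_n -> N}),
    (forall i, gr (p i) (x i)) ->
  forall i j : 'I_n, j = i.+1 :> nat ->
    br x = - ((-1) ^+ (p i * p j)%N *: br [ffun k => x (tperm i j k)]).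

(* [last] is the n-th position. The parities [p] and [q] are quantified along
   with the homogeneous elements: only 0 has two parities, and when some entry
   is 0 both sides vanish whatever the signs. *)
Definition n_hom_jacobi (gr : bool -> set N) (br : {ffun 'I_n -> N} -> N)
    (alpha : N -> N) : Prop :=
  forall (last : 'I_n), last.+1 = n ->
  forall (p : 'I_n.-1 -> bool) (x : {ffun 'I_n.-1 -> N})
         (q : 'I_n -> bool) (y : {ffun 'I_n -> N}),
    (forall k, gr (p k) (x k)) -> (forall k, gr (q k) (y k)) ->
    br (insert_at last (br y) [ffun k => alpha (x k)]) =
    \sum_(i < n)
      (-1) ^+ ((\sum_(k < n.-1) p k) * (\sum_(k < n | (k < i)%N) q k))%N *:
      br [ffun k => if k == i then br (insert_at last (y i) x)
                    else alpha (y k)].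

Record mult_n_hom_lie_superalgebra (gr : bool -> set N)
    (br : {ffun 'I_n -> N} -> N) (alpha : {linear N -> N}) : Prop := {
  nhl_grading : grading gr;
  nhl_multilinear : multilinear br;
  nhl_even_bracket : even_bracket gr br;
  nhl_even_map : even_map gr alpha;
  nhl_multiplicative : forall x : {ffun 'I_n -> N},
    alpha (br x) = br [ffun i => alpha (x i)];
  nhl_jacobi : n_hom_jacobi gr br alpha;
  nhl_skew : super_skew_symmetric gr br
}.

Definition positional_center (br : {ffun 'I_n -> N} -> N) (i : 'I_n) : set N :=
  [set z | forall x : {ffun 'I_n.-1 -> N}, br (insert_at i z x) = 0].

(* [N, .., N, I, N, .., N] is included in I, with I in position [i]. *)
Definition absorbs_at (br : {ffun 'I_n -> N} -> N) (I : set N) (i : 'I_n) :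
    Prop :=
  [set br (insert_at i z x) | z in I & x in setT] `<=` I.

End Definitions.

(* Main.v *)
Require Import Defs.
From mathcomp Require Import all_boot all_order all_algebra.
From mathcomp Require Import boolp classical_sets.

Set Implicit Arguments.
Unset Strict Implicit.
Unset Printing Implicit Defensive.

Import GRing.Theory.

Local Open Scope classical_set_scope.
Local Open Scope ring_scope.

(** Both statements have the form: if the bracket sends every tuple whose
    [i]-th entry lies in [A] into the subspace [J], then so does it for every
    tuple whose [j]-th entry lies in [A].  For (ii), [A = J = I]; for (i), [A]
    is the [i]-th positional center and [J = 0].

    On tuples of homogeneous elements this is immediate for neighbouring [i]
    and [j], because exchanging two neighbouring entries only changes the sign
    of the bracket, and arbitrary positions are joined by a chain of
    neighbours.  By multilinearity homogeneous tuples suffice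
    ([bracket_in_of_homogeneous]), provided that the homogeneous components of
    an element of [A] are again in [A]; otherwise the expansion would leave
    [A].  A graded subspace has this property by definition.  The positional
    center has it ([positional_center_homogeneous_split]) because the bracket
    is even: when the other entries are homogeneous, the even and the odd
    component of [z] contribute to the bracket of [z] terms of opposite
    parities, so that these terms vanish separately when their sum does. *)

(** * Positions joined by chains of neighbours *)

Lemma ord_neighbour_ind (n : nat) (P : 'I_n -> Prop) :
    (forall i j : 'I_n, j = i.+1 :> nat \/ i = j.+1 :> nat -> P i -> P j) ->
  forall i j, P i -> P j.
Proof.
move=> Pnext.
suff Pshift d : forall i j : 'I_n, j = (i + d)%N :> nat -> P i <-> P j.
  move=> i j; have [le_ij|/ltnW le_ji] := leqP i j.
    by have [] := Pshift (j - i)%N i j (esym (subnKC le_ij)).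
  by have [] := Pshift (i - j)%N j i (esym (subnKC le_ji)).
elim: d => [|d IH] i j; first by rewrite addn0 => /val_inj ->.
rewrite addnS => jE.
have lt_k : (i + d < n)%N by rewrite (leq_trans _ (ltn_ord j)) // jE.
have [ik ki] := IH i (Ordinal lt_k) erefl.
by split=> [/ik|Pj]; [|apply: ki; move: Pj];
  apply: Pnext; rewrite jE; [left|right].
Qed.

(** * Homogeneous components *)

Section Subspaces.

Variables (K : fieldType) (N : lmodType K) (gr : bool -> set N).

Lemma subspace0 (U : set N) : subspace U -> U 0.
Proof. by case=> U0 _; exact: set_mem U0. Qed.

Lemma subspace_lin (U : set N) (a : K) (u v : N) :
  subspace U -> U u -> U v -> U (a *: u + v).
Proof.
by case=> _ Ulin Uu Uv; apply: set_mem; apply: Ulin; exact: mem_set.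
Qed.

Lemma subspaceD (U : set N) (u v : N) :
  subspace U -> U u -> U v -> U (u + v).
Proof. by rewrite -{2}[u]scale1r; apply: subspace_lin. Qed.

Lemma subspaceZ (U : set N) (a : K) (u : N) : subspace U -> U u -> U (a *: u).
Proof.
move=> sU Uu; rewrite -[_ *: _]addr0.
by apply: subspace_lin => //; exact: subspace0.
Qed.

Lemma subspace_zero : subspace [set 0 : N].
Proof.
split=> [|a u v]; first exact: mem_set.
move=> /set_mem -> /set_mem ->.
by rewrite scaler0 addr0; exact: mem_set.
Qed.

(** The half of [graded] on which multilinear expansion relies: expanding an
    element of [B] into its homogeneous components does not leave [B]. *)
Definition homogeneous_split (B : set N) : Prop :=
  forall z, B z ->
  exists2 u : bool -> N, forall p, gr p (u p) /\ B (u p)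
                       & z = u false + u true.

Lemma graded_homogeneous_split (I : set N) :
  graded gr I -> homogeneous_split I.
Proof.
rewrite /graded /direct_sum => -[IE _] z; rewrite {1}IE.
move=> [a [Ia ga] [b [Ib gb] <-]].
by exists (fun p => if p then b else a) => // -[].
Qed.

Hypothesis Hgr : grading gr.

Lemma grading_subspace (p : bool) : subspace (gr p).
Proof. by case: Hgr => g0 g1 _; case: p. Qed.

Lemma grading_homogeneous_split : homogeneous_split setT.
Proof.
move=> z _; case: Hgr => _ _ []; move/seteqP=> [/(_ z I)] [a ga [b gb <-]] _ _.
by exists (fun p => if p then b else a) => // -[].
Qed.

Lemma homogeneous_add_eq0 (p : bool) (u v : N) :
  gr p u -> gr (~~ p) v -> u + v = 0 -> u = 0.
Proof.
move=> gu gv /eqP; rewrite addr_eq0 => /eqP uE.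
have gu' : gr (~~ p) u.
  by rewrite uE -scaleN1r; apply: subspaceZ => //; exact: grading_subspace.
case: Hgr => _ _ [_ /seteqP[disj _]].
by apply: disj; case: p gu gu' {gv}.
Qed.

(** This lets a single homogeneous element play the role of the set [A] in the
    reduction to homogeneous tuples.  Adjoining 0 makes the set closed under
    taking components: one of the two components of [c] is 0. *)
Lemma homogeneous_pair_split (p : bool) (c : N) :
  gr p c -> homogeneous_split [set w | w = c \/ w = 0].
Proof.
have gr0 q : gr q 0 by apply: subspace0; exact: grading_subspace.
move=> gc _ [->|->]; last first.
  by exists (fun=> 0); rewrite ?addr0 // => q; split=> //; right.
exists (fun q => if q == p then c else 0); last first.
  by case: p gc; rewrite ?add0r ?addr0.
by move=> q; case: eqP => [->|_]; split=> //; [left|right].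
Qed.

End Subspaces.

(** * The bracket at different positions *)

Section Bracket.

Variables (K : fieldType) (N : lmodType K) (n : nat) (gr : bool -> set N).
Variable br : {ffun 'I_n -> N} -> N.

Definition replace (y : {ffun 'I_n -> N}) (i : 'I_n) (z : N) :
    {ffun 'I_n -> N} := [ffun k => if k == i then z else y k].

Lemma insert_at_same (i : 'I_n) (z : N) (x : {ffun 'I_n.-1 -> N}) :
  insert_at i z x i = z.
Proof. by rewrite ffunE unlift_none. Qed.

Lemma replaceE (y : {ffun 'I_n -> N}) (i : 'I_n) (z : N) :
  replace y i z = insert_at i z [ffun k => y (lift i k)].
Proof.
apply/ffunP => k; rewrite !ffunE; case: unliftP => [j ->|->].
  by rewrite eq_sym (negbTE (neq_lift i j)) ffunE.
by rewrite eqxx.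
Qed.

Lemma replace_same (y : {ffun 'I_n -> N}) (i : 'I_n) : replace y i (y i) = y.
Proof. by apply/ffunP => k; rewrite ffunE; case: eqP => [->|]. Qed.

(** Restating both notions of the theorem for full tuples [y], instead of an
    element inserted into an (n-1)-tuple, makes different positions comparable:
    a transposition of positions acts on full tuples. *)
Definition bracket_maps (A J : set N) (i : 'I_n) : Prop :=
  forall y : {ffun 'I_n -> N}, A (y i) -> J (br y).

Lemma bracket_maps_insert (A J : set N) (i : 'I_n) :
  bracket_maps A J i <-> forall z x, A z -> J (br (insert_at i z x)).
Proof.
split=> [AJ z x Az|AJ y Ay]; first by apply: AJ; rewrite insert_at_same.
by rewrite -(replace_same y i) replaceE; exact: AJ.
Qed.

Lemma absorbs_atE (I : set N) (i : 'I_n) :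
  absorbs_at br I i <-> bracket_maps I I i.
Proof.
rewrite bracket_maps_insert; split=> [II z x Iz|II _ [z Iz [x _ <-]]].
  by apply: II; exists z => //; exists x.
exact: II.
Qed.

Lemma positional_centerE (A : set N) (i : 'I_n) :
  A `<=` positional_center br i <-> bracket_maps A [set 0] i.
Proof.
rewrite bracket_maps_insert; split=> [subC z x /subC Cz|brA z Az x].
  exact: Cz.
exact: brA.
Qed.

Hypothesis br_linear : multilinear br.

Lemma bracket_replaceD (y : {ffun 'I_n -> N}) (i : 'I_n) (u v : N) :
  br (replace y i (u + v)) = br (replace y i u) + br (replace y i v).
Proof.
have := br_linear i [ffun k => y (lift i k)] 1 u v.
by rewrite !scale1r !replaceE.
Qed.

Lemma bracket_replace0 (y : {ffun 'I_n -> N}) (i : 'I_n) :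
  br (replace y i 0) = 0.
Proof.
by apply: (addIr (br (replace y i 0))); rewrite -bracket_replaceD !add0r.
Qed.

(** The entries are made homogeneous one after the other; the induction is on
    the position up to which this remains to be done.  Letting each position
    have its own set [B k] lets one entry be constrained and the others be
    arbitrary. *)
Lemma bracket_in_of_homogeneous (J : set N) (B : 'I_n -> set N) :
    subspace J -> (forall k, homogeneous_split gr (B k)) ->
    (forall (p : 'I_n -> bool) (y : {ffun 'I_n -> N}),
       (forall k, gr (p k) (y k)) -> (forall k, B k (y k)) -> J (br y)) ->
  forall y : {ffun 'I_n -> N}, (forall k, B k (y k)) -> J (br y).
Proof.
move=> sJ Bsplit Jhom y By.
suff Jm m : forall (p : 'I_n -> bool) (x : {ffun 'I_n -> N}),
    (forall k : 'I_n, (m <= k)%N -> gr (p k) (x k)) ->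
    (forall k, B k (x k)) -> J (br x).
  by apply: (Jm n (fun=> false)) => // k; rewrite leqNgt ltn_ord.
elim: m => [|m IH] p x gx Bx; first by apply: (Jhom p) => // k; exact: gx.
have [lt_mn|le_nm] := ltnP m n; last first.
  apply: (IH p) => // k le_mk.
  by have := ltn_ord k; rewrite ltnNge (leq_trans le_nm).
pose k0 := Ordinal lt_mn.
have [u gBu xE] := Bsplit k0 _ (Bx k0).
rewrite -(replace_same x k0) xE bracket_replaceD.
suff Ju q : J (br (replace x k0 (u q))) by exact: subspaceD.
have [gu Bu] := gBu q.
apply: (IH (fun k => if k == k0 then q else p k)) => k; last first.
  by rewrite ffunE; case: eqP => [->|].
rewrite ffunE; case: eqP => [//|/eqP k_neq le_mk].
by apply: gx; rewrite ltn_neqAle eq_sym k_neq.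
Qed.

Hypothesis Hgr : grading gr.

(** For neighbouring positions, the reduction to homogeneous tuples restricts
    only the entry at the target [j] to [A]; swapping [i] and [j] brings this
    entry to [i], and the resulting sign is harmless since [J] is a
    subspace. *)
Lemma bracket_maps_move (A J : set N) (i j : 'I_n) :
    super_skew_symmetric gr br -> subspace J -> homogeneous_split gr A ->
  bracket_maps A J i -> bracket_maps A J j.
Proof.
move=> skew sJ Asplit; move: i j; apply: ord_neighbour_ind => i j ij AJ y Ay.
apply: (@bracket_in_of_homogeneous J (fun k => if k == j then A else setT)).
- exact: sJ.
- by move=> k; case: eqP => // _; exact: grading_homogeneous_split.
- move=> p {Ay}y gy /(_ j); rewrite eqxx => Ay.
  have Jswap : J (br [ffun k => y (tperm i j k)]).
    by apply: AJ; rewrite ffunE tpermL.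
  suff [s ->] : exists s, br y = - (s *: br [ffun k => y (tperm i j k)]).
    by rewrite -scaleNr; exact: subspaceZ.
  case: ij => [ji|ij]; first by exists ((-1) ^+ (p i * p j)%N); exact: skew.
  by exists ((-1) ^+ (p j * p i)%N); rewrite tpermC; exact: skew.
- by move=> k; case: eqP => [->|].
Qed.

Hypothesis br_even : even_bracket gr br.

(** If [z] is central, the brackets of its two components add up to 0, and for
    homogeneous other entries they have opposite parities, so both vanish.
    Multilinearity extends this to arbitrary other entries. *)
Lemma positional_center_homogeneous_split (i : 'I_n) :
  homogeneous_split gr (positional_center br i).
Proof.
move=> z Cz; have [u gu zE] := grading_homogeneous_split Hgr (I : setT z).
exists u => // p; have gup q : gr q (u q) by have [] := gu q.
split; first exact: gup.
suff : bracket_maps [set w | w = u p \/ w = 0] [set 0] i.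
  by move/positional_centerE; apply; left.
move=> y uy.
apply: (@bracket_in_of_homogeneous [set 0]
  (fun k => if k == i then [set w | w = u p \/ w = 0] else setT)).
- exact: subspace_zero.
- move=> k; case: eqP => _; last exact: grading_homogeneous_split.
  exact: homogeneous_pair_split (gup p).
- move=> q {uy}y gy /(_ i); rewrite eqxx => -[yi|yi]; last first.
    by rewrite -(replace_same y i) yi; exact: bracket_replace0.
  pose s := \big[addb/false]_(k < n | k != i) q k.
  have gr_br r : gr (r (+) s) (br (replace y i (u r))).
    have := br_even (p := fun k => if k == i then r else q k)
      (x := replace y i (u r)).
    rewrite (bigD1 i) //= eqxx.
    rewrite (eq_bigr q); last by move=> k /negbTE ->.
    by apply=> k; rewrite ffunE; case: eqP.
  have sum0 : br (replace y i (u p)) + br (replace y i (u (~~ p))) = 0.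
    rewrite -bracket_replaceD (_ : u p + u (~~ p) = z).
      by rewrite replaceE; exact: Cz.
    by rewrite zE; case: p {yi} => //; rewrite addrC.
  rewrite -(replace_same y i) yi.
  apply: (homogeneous_add_eq0 Hgr (gr_br p) _ sum0).
  by rewrite -addNb; exact: gr_br.
- by move=> k; case: eqP => [->|].
Qed.

End Bracket.

Theorem proposition3p10 (K : fieldType) (charK : [pchar K] =i pred0)
    (n : nat) (n_ge2 : (2 <= n)%N) (N : lmodType K) (gr : bool -> set N)
    (br : {ffun 'I_n -> N} -> N) (alpha : {linear N -> N})
    (HN : mult_n_hom_lie_superalgebra gr br alpha) :
  (forall i j : 'I_n, positional_center br i = positional_center br j) /\
  (forall I : set N, subspace I -> graded gr I -> stable alpha I ->
     forall i : 'I_n, absorbs_at br I i ->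
     forall j : 'I_n, absorbs_at br I j).
Proof.
have [Hgr lin even _ _ _ skew] := HN.
split=> [i j|I sI gI _ i Ii j].
  suff sub k l : positional_center br k `<=` positional_center br l.
    by apply/seteqP; split; exact: sub.
  apply/positional_centerE; apply: (bracket_maps_move lin Hgr skew (i := k)).
  - exact: subspace_zero.
  - exact: positional_center_homogeneous_split.
  - exact/positional_centerE.
apply/absorbs_atE; apply: (bracket_maps_move lin Hgr skew sI (i := i)).
  exact: graded_homogeneous_split.
exact/absorbs_atE.
Qed.
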